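(* Let $n > 3$ and let $\mathcal{B}$ be the block diagonal matching field for $\mathrm{Gr}(3,n)$. The FFLV-polytope $\mathcal{C}(Q_{3,n})$ for $\mathrm{Gr}(3,n)$ is unimodular equivalent to the matching field polytope $P_{\mathcal{B}}$.
   Context: Write $[n]=\{1,\dots,n\}$. Block diagonal matching field. The block diagonal matching field $\mathcal{B}$ for $\mathrm{Gr}(3,n)$ is the matching field induced by the $3\times n$ weight matrix with first row $(0,\dots,0)$, second row $(0,n-1,n-2,\dots,1)$, and third row with $j$-th entry $(n-j)n$. (The matching field induced by a matrix $M$ assigns to each $J$ the ordering of its elements $(a_1,a_2,a_3)$ minimizing $\sum_i M_{i,a_i}$.) Equivalently, for each $3$-subset $J=\{j_1<j_2<j_3\}\subseteq[n]$, its tuple is $(j_2,j_1,j_3)$ if $1\in J$ and $(j_1,j_2,j_3)$ if $1\notin J$. With $e_{i,j}$ the standard basis of $\mathbb{R}^{3\times n}$, the matching field polytope is $P_{\mathcal{B}}=\mathrm{Conv}\{e_{1,a_1}+e_{2,a_2}+e_{3,a_3} : (a_1,a_2,a_3)\text{ a tuple of }\mathcal{B}\}\subseteq\mathbb{R}^{3\times n}$. FFLV-polytope. Let $Q_{3,n} = \{(i,j)\in\mathbb{Z}^2 : 1\le i\le 3,\ 1 \le j \le n-3\}$ be the poset with $(a,b) \le (c,d)$ iff $a \le c$ and $b \le d$. For a finite poset $\Pi=\{p_1,\dots,p_d\}$ the chain polytope is $\mathcal{C}(\Pi)=\{x\in\mathbb{R}^d : x_{i_1}+\dots+x_{i_s}\le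 1 \text{ if } p_{i_1}<\dots<p_{i_s},\ x_i\ge 0 \text{ for all } i\}$. The FFLV-polytope for $\mathrm{Gr}(3,n)$ is defined to be $\mathcal{C}(Q_{3,n})$. Two lattice polytopes $P,Q$ are unimodular equivalent if there is an affine isomorphism between their affine spans that maps $P$ onto $Q$ and restricts to a bijection between their distinguished lattices, the distinguished lattice of a polytope being the $\mathbb{Z}$-affine span of its vertices. *)

(* Defs.v *)
From mathcomp Require Import all_boot all_order all_algebra.
From mathcomp Require Import boolp classical_sets functions reals.

Set Implicit Arguments.
Unset Strict Implicit.
Unset Printing Implicit Defensive.

Import Order.TTheory GRing.Theory Num.Theory.

Local Open Scope ring_scope.

Definition ordering_of (k n : nat) (J : {set 'I_n})
    (a : {ffun 'I_k -> 'I_n}) : bool :=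
  injectiveb a && ([set a i | i in 'I_k]%SET == J).

Definition tuple_weight (k n : nat) (M : 'M[nat]_(k, n))
    (a : {ffun 'I_k -> 'I_n}) : nat :=
  (\sum_(i < k) M i (a i))%N.

(* For [M] generic (no ties), exactly one ordering of each [k]-subset [J]
   satisfies this; it is the tuple that the field assigns to [J]. *)
Definition induced_tuple_of (k n : nat) (M : 'M[nat]_(k, n)) (J : {set 'I_n})
    (a : {ffun 'I_k -> 'I_n}) : bool :=
  ordering_of J a &&
  [forall b : {ffun 'I_k -> 'I_n},
     ordering_of J b ==> (tuple_weight M a <= tuple_weight M b)%N].

Definition matching_field_tuple (k n : nat) (M : 'M[nat]_(k, n))
    (a : {ffun 'I_k -> 'I_n}) : bool :=
  [exists J : {set 'I_n}, (#|J| == k) && induced_tuple_of M J a].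

(* Rows and columns are numbered from 0, so the mathematical column index is
   [j.+1].  The rows are (0, ..., 0), (0, n-1, n-2, ..., 1) and
   ((n-1)n, (n-2)n, ..., n, 0). *)
Definition block_diagonal_weight (n : nat) : 'M[nat]_(3, n) :=
  \matrix_(i < 3, j < n)
    match val i with
    | 0 => 0
    | 1 => if val j == 0 then 0 else n - j
    | _ => (n - j.+1) * n
    end%N.

Local Open Scope classical_set_scope.

Definition conv_hull (R : realFieldType) (V : lmodType R) (S : set V)
    : set V :=
  [set x | exists (m : nat) (v : 'I_m -> V) (c : 'I_m -> R),
    [/\ forall i, S (v i), forall i, 0 <= c i, \sum_(i < m) c i = 1
      & x = \sum_(i < m) c i *: v i]].

Definition affine_span (R : realFieldType) (V : lmodType R) (S : set V)
    : set V :=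
  [set x | exists (m : nat) (v : 'I_m -> V) (c : 'I_m -> R),
    [/\ forall i, S (v i), \sum_(i < m) c i = 1
      & x = \sum_(i < m) c i *: v i]].

Definition int_affine_span (V : zmodType) (S : set V) : set V :=
  [set x | exists (m : nat) (v : 'I_m -> V) (c : 'I_m -> int),
    [/\ forall i, S (v i), \sum_(i < m) c i = 1
      & x = \sum_(i < m) v i *~ c i]].

(* The vertices of a polytope are its extreme points. *)
Definition vertices (R : realFieldType) (V : lmodType R) (P : set V)
    : set V :=
  [set x | P x /\ forall (y z : V) (t : R), P y -> P z -> 0 < t < 1 ->
    x = t *: y + (1 - t) *: z -> y = x /\ z = x].

Definition distinguished_lattice (R : realFieldType) (V : lmodType R)
    (P : set V) : set V :=
  int_affine_span (vertices P).

Definition affine_on (R : realFieldType) (V W : lmodType R) (A : set V)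
    (f : V -> W) : Prop :=
  forall (x y : V) (t : R), A x -> A y ->
    f (t *: x + (1 - t) *: y) = t *: f x + (1 - t) *: f y.

(* Meaningful for lattice polytopes.  Only the values of [f] on the affine span
   of [P] matter: [f] stands for a map defined there. *)
Definition unimodular_equivalent (R : realFieldType) (V W : lmodType R)
    (P : set V) (Q : set W) : Prop :=
  exists f : V -> W,
    [/\ affine_on (affine_span P) f,
        set_bij (affine_span P) (affine_span Q) f,
        f @` P = Q
      & set_bij (distinguished_lattice P) (distinguished_lattice Q) f].

Definition chain_polytope (R : realFieldType) (d : Order.disp_t)
    (T : finPOrderType d) : set {ffun T -> R^o} :=
  [set x : {ffun T -> R^o} |
    (forall s : seq T, sorted <%O s -> \sum_(p <- s) x p <= 1) /\
    (forall p : T, 0 <= x p)].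
Arguments chain_polytope R {d} T.

(* The poset {1, 2, 3} x {1, ..., n-3} with the componentwise order, numbered
   from 0. *)
Definition Q3 (n : nat) : finPOrderType _ := ('I_3 *p 'I_(n - 3))%type.

Definition FFLV_polytope (R : realFieldType) (n : nat)
    : set {ffun Q3 n -> R^o} :=
  chain_polytope R (Q3 n).
Arguments FFLV_polytope R n : clear implicits.

Definition matching_field_polytope (R : realFieldType) (k n : nat)
    (M : 'M[nat]_(k, n)) : set 'M[R]_(k, n) :=
  conv_hull [set x | exists a : {ffun 'I_k -> 'I_n},
    matching_field_tuple M a /\ x = \sum_(i < k) delta_mx i (a i)].
Arguments matching_field_polytope R {k n} M.

(* Main.v *)
From HB Require Import structures.
Require Import Defs.
From mathcomp Require Import all_boot all_order all_algebra.
From mathcomp Require Import boolp classical_sets functions reals.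
From mathcomp Require Import zify perm.

(** An explicit injective affine map carries the chain polytope onto the
matching field polytope, and this is all that has to be checked.  Indeed the
distinguished lattice is the integer affine span of the vertices; an injective
affine map preserves vertices and commutes with integer affine combinations, so
it automatically matches the lattices ([affine_unimodular_equivalent]).

By Stanley's theorem, the chain polytope of a finite poset is the convex hull of
the indicators of its antichains ([chain_polytope_conv_hull]).  Hence it
suffices that the affine map sends the antichains of [Q3 n] onto the
tuples of the matching field.

An antichain of [Q3 n] has at most one cell in each of the three rows, and its
columns strictly decrease from row to row.  Read the rows in reverse order and
shift the columns by 2: the occupied rows of the 3 by n matrix then
carry strictly increasing columns in the range from 2 to n - 2.  A tuple
(a0, a1, a2) of the block diagonal field is, with columns numbered from 0, a triple with
0 < a0 < a2 and either a1 = 0 or a0 < a1 < a2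
([block_diagonal_tupleP]).  Let an empty row be recorded by the extreme column
left over for it, namely 1, 0 and n - 1 in rows 0, 1 and 2
([absent_col]).  Column 1 of row 0 and column n - 1 of row 2 satisfy every
inequality with the columns of the other rows, and a1 = 0 is the exceptional
case of the field, so the antichain condition is exactly the tuple condition
([antichain_cells_tuple]).  The map is affine since the weight on the extra column
of a row is 1 minus the sum of the other weights of that row; it is injective
since the other entries are the original coordinates. *)

Set Implicit Arguments.
Unset Strict Implicit.
Unset Printing Implicit Defensive.

Import Order.TTheory GRing.Theory Num.Theory.

Local Open Scope classical_set_scope.
Local Open Scope ring_scope.

(** * Injective affine maps are unimodular equivalences *)

Section AffineMaps.
Variables (R : realFieldType) (V W : lmodType R).
Variables (L : {linear V -> W}) (w0 : W).

Let f (x : V) : W := w0 + L x.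

Lemma affine_comb (m : nat) (c : 'I_m -> R) (v : 'I_m -> V) :
  \sum_(i < m) c i = 1 -> f (\sum_(i < m) c i *: v i) = \sum_(i < m) c i *: f (v i).
Proof.
move=> c1; rewrite /f linear_sum; under [RHS]eq_bigr do rewrite scalerDr.
rewrite big_split -scaler_suml c1 scale1r /=; congr (_ + _).
by apply: eq_bigr => i _; rewrite linearZ.
Qed.

Lemma int_affine_comb (m : nat) (c : 'I_m -> int) (v : 'I_m -> V) :
  \sum_(i < m) c i = 1 -> f (\sum_(i < m) v i *~ c i) = \sum_(i < m) f (v i) *~ c i.
Proof.
move=> c1.
under eq_bigr do rewrite -scaler_int; under [RHS]eq_bigr do rewrite -scaler_int.
by apply: affine_comb; rewrite -rmorph_sum c1.
Qed.

Lemma image_family (S : set V) (m : nat) (w : 'I_m -> W) :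
  (forall i, (f @` S) (w i)) ->
  exists v : 'I_m -> V, (forall i, S (v i)) /\ w = f \o v.
Proof.
move=> Sw; have /choice[v vP] : forall i, exists x, S x /\ f x = w i.
  by move=> i; case: (Sw i) => x Sx <-; exists x.
by exists v; split=> [i|]; [case: (vP i) | apply/funext => i; case: (vP i)].
Qed.

Lemma image_conv_hull (S : set V) : f @` conv_hull S = conv_hull (f @` S).
Proof.
apply/seteqP; split=> [_ [_ [m [v [c [Sv c0 c1 ->]]]] <-] | _ [m [w [c [Sw c0 c1 ->]]]]].
  exists m, (f \o v), c; split=> // [i|]; first by exists (v i).
  exact: affine_comb.
have [v [Sv ->]] := image_family Sw.
by exists (\sum_i c i *: v i); [exists m, v, c | exact: affine_comb].
Qed.

Lemma image_affine_span (S : set V) : f @` affine_span S = affine_span (f @` S).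
Proof.
apply/seteqP; split=> [_ [_ [m [v [c [Sv c1 ->]]]] <-] | _ [m [w [c [Sw c1 ->]]]]].
  exists m, (f \o v), c; split=> // [i|]; first by exists (v i).
  exact: affine_comb.
have [v [Sv ->]] := image_family Sw.
by exists (\sum_i c i *: v i); [exists m, v, c | exact: affine_comb].
Qed.

Lemma image_int_affine_span (S : set V) :
  f @` int_affine_span S = int_affine_span (f @` S).
Proof.
apply/seteqP; split=> [_ [_ [m [v [c [Sv c1 ->]]]] <-] | _ [m [w [c [Sw c1 ->]]]]].
  exists m, (f \o v), c; split=> // [i|]; first by exists (v i).
  exact: int_affine_comb.
have [v [Sv ->]] := image_family Sw.
by exists (\sum_i v i *~ c i); [exists m, v, c | exact: int_affine_comb].
Qed.

Lemma affine_segment (x y : V) (t : R) :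
  f (t *: x + (1 - t) *: y) = t *: f x + (1 - t) *: f y.
Proof.
rewrite /f linearD !linearZ !scalerDr addrACA -scalerDl.
by rewrite [t + _]addrC subrK scale1r.
Qed.

Hypothesis L_inj : injective L.

Lemma affine_inj : injective f.
Proof. by move=> x y /addrI /L_inj. Qed.

(** Injectivity lets an equation between convex combinations in the image be
pulled back to the source, where extremality is known. *)
Lemma image_vertices (P : set V) : f @` vertices P = vertices (f @` P).
Proof.
apply/seteqP; split=> [_ [x [Px xP] <-] | _ [[x Px <-] xP]].
  split=> [|_ _ t [y Py <-] [z Pz <-] t01]; first by exists x.
  by rewrite -affine_segment => /affine_inj/(xP y z t Py Pz t01)[-> ->].
exists x => //; split=> // y z t Py Pz t01 xE.
have [] := xP (f y) (f z) t; rewrite -?affine_segment -?xE //.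
by move=> /affine_inj-> /affine_inj->.
Qed.

(** The condition on lattices comes for free, because the lattice is defined
from the vertices, which are an affine invariant. *)
Lemma affine_unimodular_equivalent (P : set V) (Q : set W) :
  f @` P = Q -> unimodular_equivalent P Q.
Proof.
have bij (A : set V) (B : set W) : f @` A = B -> set_bij A B f.
  move=> <-; split; first by move=> x Ax; exists x.
  - by move=> x y _ _; exact: affine_inj.
  - exact: subset_refl.
move=> fPQ; exists f; split=> //.
- by move=> x y t _ _; exact: affine_segment.
- by apply: bij; rewrite image_affine_span fPQ.
- by apply: bij; rewrite image_int_affine_span image_vertices fPQ.
Qed.

End AffineMaps.

(** * The chain polytope is spanned by antichains *)

Section ChainPolytope.
Variables (d : Order.disp_t) (T : finPOrderType d).

Definition antichain (A : {set T}) : Prop :=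
  {in A &, forall p q, (p <= q)%O -> p = q}.

Definition indicator (R : realFieldType) (A : {set T}) : {ffun T -> R^o} :=
  [ffun p => (p \in A)%:R].

(** A chain meets an antichain at most once. *)
Lemma sum_indicator_chain (R : realFieldType) (A : {set T}) (s : seq T) :
  antichain A -> sorted <%O s -> \sum_(p <- s) indicator R A p <= 1.
Proof.
move=> antiA s_chain.
have -> : \sum_(p <- s) indicator R A p = (\sum_(p <- s) (p \in A))%:R :> R.
  by rewrite natr_sum; apply: eq_bigr => p _; rewrite ffunE.
rewrite lern1 -big_mkcond sum1_count -size_filter.
have : sorted <%O (filter (mem A) s) by apply: sorted_filter => //; exact: lt_trans.
have : all (mem A) (filter (mem A) s) by apply: filter_all.
case: filter => [|p [|q u]] //= /and3P[Ap Aq _] /andP[lt_pq _].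
by have := antiA p q Ap Aq (ltW lt_pq) => eq_pq; rewrite eq_pq ltxx in lt_pq.
Qed.

(** This is Stanley's transfer map to the order polytope: [y p] is the largest
total weight of a chain with top [p].  A chain ending at [p] can be
prolonged by any [q] above [p], so the intervals from [y p - x p] to [y p], of
length [x p], are disjoint and ordered along every chain. *)
Lemma chain_polytope_potential (R : realType) (x : {ffun T -> R^o}) :
  chain_polytope R T x ->
  exists y : T -> R, [/\ forall p, x p <= y p, forall p, y p <= 1
    & forall p q, (p < q)%O -> y p <= y q - x q].
Proof.
move=> [x_chain x_ge0].
pose E (p : T) : set R :=
  [set r | exists2 s : seq T, sorted <%O (rcons s p) & r = \sum_(q <- rcons s p) x q].
have Ex p : E p (x p) by exists [::] => //=; rewrite big_seq1.
have Eub p : ubound (E p) 1 by move=> _ [s /x_chain s1 ->].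
have Esup p : has_sup (E p) by split; [exists (x p) | exists 1].
exists (fun p => sup (E p)); split=> [p|p|p q lt_pq].
- by apply: sup_upper_bound.
- exact: ge_sup (ex_intro _ _ (Ex p)) (Eub p).
apply: ge_sup; first by exists (x p).
move=> _ [s s_chain ->]; rewrite lerBrDr; apply: sup_upper_bound => //.
exists (rcons s p); last by rewrite -[in RHS](cats1 _ q) big_cat big_seq1.
by rewrite -cats1 cat_rcons sorted_cat_cons /= lt_pq s_chain.
Qed.

(** The length of an interval whose ends lie on a grid is the sum of the grid
steps inside it; the membership test is on the right end of each step. *)
Lemma telescope_steps (R : realFieldType) (s : seq R) (a b : R) :
  sorted <%R s -> a \in s -> b \in s -> a <= b ->
  \sum_(i < (size s).-1) (s`_i.+1 - s`_i) * (a < s`_i.+1 <= b)%R%:R = b - a.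
Proof.
move=> s_lt /(nthP 0)[j js <-] /(nthP 0)[k ks <-].
have le_nth := lt_sorted_leq_nth 0 s_lt; have lt_nth := lt_sorted_ltn_nth 0 s_lt.
rewrite le_nth // => jk; rewrite -(telescope_sumr _ jk).
rewrite -(big_mkord xpredT (fun i => (s`_i.+1 - s`_i) * (s`_j < s`_i.+1 <= s`_k)%R%:R)).
have k_le : (k <= (size s).-1)%N by rewrite -ltnS (ltn_predK ks).
rewrite [RHS](big_nat_widen _ _ (size s).-1) // [RHS](big_nat_widenl j 0) //.
rewrite [RHS]big_mkcond big_nat_cond [RHS]big_nat_cond /=.
apply: eq_bigr => i; rewrite andbT => i_s.
have i_lt : (i.+1 < size s)%N by lia.
rewrite lt_nth ?le_nth ?inE // ltnS [in RHS]andbC.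
by case: ifP; rewrite ?mulr1 ?mulr0.
Qed.

(** For a threshold [t] between 0 and 1, the elements [p] with
[y p - x p < t <= y p] form an antichain, since these intervals are disjoint
along chains.  For uniform [t] the element [p] is selected with probability
[x p], so [x] is the average of these antichains; the average is a finite convex
combination because the antichain changes only at the ends of the intervals. *)
Lemma chain_polytope_conv_hull (R : realType) :
  chain_polytope R T = conv_hull [set indicator R A | A in [set A | antichain A]].
Proof.
apply/seteqP; split=> [x xP | _ [m [v [c [vA c0 c1 ->]]]]]; last first.
  have vE i : exists2 A, antichain A & v i = indicator R A.
    by case: (vA i) => A anti <-; exists A.
  split=> [s s_chain|p]; last first.
    rewrite sum_ffunE; apply: sumr_ge0 => i _; case: (vE i) => A _ ->.
    by rewrite !ffunE mulr_ge0.
  under eq_bigr do rewrite sum_ffunE; rewrite exchange_big -c1 /=.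
  apply: ler_sum => i _; case: (vE i) => A antiA ->.
  under eq_bigr do rewrite ffunE; rewrite -scaler_sumr.
  by rewrite -[leRHS]mulr1 ler_wpM2l // sum_indicator_chain.
have [y [le_xy y_le1 y_lt]] := chain_polytope_potential xP.
have x_ge0 : forall p, 0 <= x p by case: xP.
(* The grid: all ends of intervals, together with the ends of the unit interval. *)
pose s := sort <=%R (undup (0 :: 1 :: [seq y p | p : T] ++ [seq y p - x p | p : T])).
have s_lt : sorted <%R s by rewrite sort_lt_sorted undup_uniq.
have y_s p : y p \in s.
  by rewrite mem_sort mem_undup !inE mem_cat fintype.image_f ?orbT.
have yx_s p : y p - x p \in s.
  by rewrite mem_sort mem_undup !inE mem_cat (fintype.image_f (fun p => y p - x p)) ?orbT.
have s0 : 0 \in s by rewrite mem_sort mem_undup !inE eqxx.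
have s1 : 1 \in s by rewrite mem_sort mem_undup !inE eqxx orbT.
have s01 t : t \in s -> 0 <= t <= 1.
  rewrite mem_sort mem_undup !inE mem_cat.
  case/or4P=> [/eqP->|/eqP->|/fintype.imageP[p _ ->]|/fintype.imageP[p _ ->]].
  - by rewrite lexx ler01.
  - by rewrite lexx ler01.
  - by rewrite y_le1 (le_trans (x_ge0 p)).
  - by rewrite subr_ge0 le_xy lerBlDr (le_trans (y_le1 p)) // lerDl.
have i_lt (i : 'I_(size s).-1) : (i.+1 < size s)%N by rewrite -ltn_predRL.
have step (i : 'I_(size s).-1) : s`_i < s`_i.+1.
  by rewrite (lt_sorted_ltn_nth 0 s_lt) ?inE // ltnW.
pose A t := [set p | y p - x p < t <= y p]%SET.
exists (size s).-1, (fun i => indicator R (A s`_i.+1)), (fun i => s`_i.+1 - s`_i).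
split.
- move=> i; exists (A s`_i.+1) => // p q.
  rewrite !inE => /andP[_ ty] /andP[yt _]; rewrite le_eqVlt => /predU1P[//|lt_pq].
  by have := lt_le_trans yt (le_trans ty (y_lt _ _ lt_pq)); rewrite ltxx.
- by move=> i; rewrite subr_ge0 ltW.
- rewrite -[RHS]subr0 -(telescope_steps s_lt s0 s1 ler01).
  apply: eq_bigr => i _; have i_s : s`_i.+1 \in s.
    by rewrite mem_nth.
  have /andP[s_ge0 ->] := s01 _ i_s.
  have /andP[si0 _] : 0 <= s`_i <= 1 by rewrite s01 // mem_nth // ltnW.
  by rewrite (le_lt_trans si0) // mulr1.
apply/ffunP => p; rewrite sum_ffunE.
have -> : x p = y p - (y p - x p) by rewrite subKr.
rewrite -(telescope_steps s_lt (yx_s p) (y_s p)); last by rewrite gerBl.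
by apply: eq_bigr => i _; rewrite !ffunE inE.
Qed.

End ChainPolytope.

(** * The tuples of the block diagonal matching field *)

Definition r0 : 'I_3 := inord 0.
Definition r1 : 'I_3 := inord 1.
Definition r2 : 'I_3 := inord 2.

Lemma ord3P (i : 'I_3) : [\/ i = r0, i = r1 | i = r2].
Proof.
case: i => [[|[|[|//]]] lti]; [apply: Or31|apply: Or32|apply: Or33];
  by apply/val_inj; rewrite /= inordK.
Qed.

Lemma sum3 (F : 'I_3 -> nat) : (\sum_i F i = F r0 + F r1 + F r2)%N.
Proof.
rewrite !big_ord_recr big_ord0 /= add0n.
by congr (F _ + F _ + F _)%N; apply/val_inj; rewrite /= inordK.
Qed.

Lemma ordering_of_perm (k n : nat) (J : {set 'I_n}) (a : {ffun 'I_k -> 'I_n}) (s : 'S_k) :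
  ordering_of J a -> ordering_of J [ffun i => a (s i)].
Proof.
case/andP=> /injectiveP a_inj /eqP <-; apply/andP; split.
  by apply/injectiveP => i j; rewrite !ffunE => /a_inj/perm_inj.
apply/eqP/setP => x; apply/imsetP/imsetP => -[i _ ->].
  by exists (s i); rewrite ?ffunE.
by exists (s^-1%g i); rewrite ?ffunE ?permKV.
Qed.

(** Entries of the last row of the weight matrix differ by at least [n], more
than any difference in the middle row, so the largest element must come last.
The two others are then ordered by the middle row, whose entries decrease
except that the first one is 0, the least of all.  Conversely, optimality
against the three transpositions of a tuple already forces these inequalities. *)
Lemma block_diagonal_tupleP (n : nat) (a : {ffun 'I_3 -> 'I_n}) :
  matching_field_tuple (block_diagonal_weight n) a <->
  (0 < a r0 < a r2)%N /\ (a r1 = 0 :> nat \/ (a r0 < a r1 < a r2)%N).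
Proof.
have r01 : r0 != r1 by rewrite -val_eqE /= !inordK.
have r02 : r0 != r2 by rewrite -val_eqE /= !inordK.
have r12 : r1 != r2 by rewrite -val_eqE /= !inordK.
pose u (j : nat) := (if j == 0 then 0 else n - j)%N.
pose w (j : nat) := ((n - j.+1) * n)%N.
have weightE (b : {ffun 'I_3 -> 'I_n}) :
    tuple_weight (block_diagonal_weight n) b = (u (b r1) + w (b r2))%N.
  by rewrite /tuple_weight sum3 !mxE /= !inordK.
have u_lt j : (j < n -> u j < n)%N by rewrite /u; case: eqP; lia.
have w_gap i j : (i < j < n -> w j + n <= w i)%N.
  by move=> ij; rewrite /w -[X in (_ + X)%N]mul1n -mulnDl leq_mul2r; lia.
split.
  case/existsP => J /andP[_ /andP[aJ /forallP a_min]].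
  have {}a_min (s : {perm 'I_3}) : (u (a r1) + w (a r2) <= u (a (s r1)) + w (a (s r2)))%N.
    have /implyP := a_min [ffun i => a (s i)].
    by rewrite !weightE !ffunE; apply; apply: ordering_of_perm.
  have /andP[/injectiveP a_inj _] := aJ.
  have a01 : a r0 != a r1 :> nat by rewrite val_eqE (inj_eq a_inj).
  have a02 : a r0 != a r2 :> nat by rewrite val_eqE (inj_eq a_inj).
  have a12 : a r1 != a r2 :> nat by rewrite val_eqE (inj_eq a_inj).
  have := a_min (tperm r0 r1); have := a_min (tperm r0 r2); have := a_min (tperm r1 r2).
  rewrite !tpermL !tpermR !tpermD // 1?eq_sym // => m12 m02 m01.
  have lt12 : (a r1 < a r2)%N.
    rewrite ltnNge; apply/negP => le21.
    have := @w_gap (a r2) (a r1); have := u_lt (a r1) (ltn_ord _).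
    have := u_lt (a r2) (ltn_ord _). have := ltn_ord (a r1). lia.
  have lt02 : (a r0 < a r2)%N.
    rewrite ltnNge; apply/negP => le20.
    have := @w_gap (a r2) (a r0); have := ltn_ord (a r0). lia.
  move: m01; rewrite /u leq_add2r; have := ltn_ord (a r0); have := ltn_ord (a r1).
  by do 2![case: eqP]; lia.
move=> aP.
have [a0_gt0 lt02 a1P] : [/\ 0 < a r0, a r0 < a r2 & a r1 = 0 :> nat \/ a r0 < a r1 < a r2]%N.
  by case: aP => /andP[].
have lt12 : (a r1 < a r2)%N by case: a1P => [->|/andP[]//]; lia.
have a01 : a r0 != a r1 by rewrite -val_eqE /=; lia.
have a02 : a r0 != a r2 by rewrite -val_eqE /=; lia.
have a12 : a r1 != a r2 by rewrite -val_eqE /=; lia.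
have a_inj : injective a.
  move=> i j; case: (ord3P i) => ->; case: (ord3P j) => -> // /eqP;
    by rewrite ?(negPf a01) ?(negPf a02) ?(negPf a12) // eq_sym
      ?(negPf a01) ?(negPf a02) ?(negPf a12).
apply/existsP; exists [set a i | i in 'I_3]%SET; rewrite card_imset // card_ord eqxx /=.
apply/andP; split; first by apply/andP; split=> //; apply/injectiveP.
apply/forallP => b; apply/implyP => /andP[/injectiveP b_inj /eqP ba].
have bE i : [\/ b i = a r0, b i = a r1 | b i = a r2].
  have : b i \in [set a j | j in 'I_3]%SET by rewrite -ba imset_f.
  by case/imsetP => j _ ->; case: (ord3P j) => ->; [apply: Or31|apply: Or32|apply: Or33].
have b12 : b r1 != b r2 by rewrite (inj_eq b_inj).
have gap0 := @w_gap (a r0) (a r2); have gap1 := @w_gap (a r1) (a r2).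
have ua1 := u_lt _ (ltn_ord (a r1)); have lta2 := ltn_ord (a r2).
have u01 : (u (a r1) <= u (a r0))%N.
  by rewrite /u; do 2![case: eqP]; have := ltn_ord (a r0); lia.
rewrite !weightE; move: b12.
case: (bE r2) => ->; case: (bE r1) => ->; rewrite ?eqxx // => _; lia.
Qed.

(** * The affine map from antichains to tuples *)

Section FFLV.
Variables (R : realFieldType) (n : nat).

(** The column that records an empty row: the column usable in row [i] other
than those from 2 to [n + 2], which stand for the cells of the poset. *)
Definition absent_col (i : 'I_3) : 'I_n.+4 :=
  inord (match val i with 0 => 1 | 1 => 0 | _ => n.+3 end)%N.

Definition col (b : 'I_(n.+4 - 3)) : 'I_n.+4 := inord b.+2.

Lemma val_col b : col b = b.+2 :> nat.
Proof. by rewrite inordK //; have := ltn_ord b; lia. Qed.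

Lemma col_inj : injective col.
Proof. by move=> b c /(congr1 val) /=; rewrite !val_col => -[/val_inj]. Qed.

Lemma val_absent_col :
  [/\ absent_col r0 = 1 :> nat, absent_col r1 = 0 :> nat
    & absent_col r2 = n.+3 :> nat]%N.
Proof. by rewrite /absent_col /= !inordK. Qed.

Lemma col_absent i b : (col b == absent_col i) = false.
Proof.
apply/negP => /eqP/(congr1 val) /=; rewrite val_col.
have [e0 e1 e2] := val_absent_col; have := ltn_ord b.
by case: (ord3P i) => ->; rewrite ?e0 ?e1 ?e2; lia.
Qed.

Lemma col_cover (a : 'I_n.+4) :
  (2 <= a < n.+3)%N -> exists b, a = col b.
Proof.
move=> a_range; have b_lt : (a - 2 < n.+4 - 3)%N by lia.
by exists (Ordinal b_lt); apply/val_inj; rewrite /= val_col /=; lia.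
Qed.

(** Raising the coordinate of a cell moves weight within its matrix row from the
column for emptiness to the column of the cell.  The rows are reversed because
columns decrease from row to row in an antichain and increase in a tuple. *)
Definition fflv_linear (x : {ffun Q3 n.+4 -> R^o}) : 'M[R]_(3, n.+4) :=
  \sum_i \sum_b x (rev_ord i, b) *:
    (delta_mx i (col b) - delta_mx i (absent_col i)).

Lemma fflv_linear_is_linear : linear fflv_linear.
Proof.
move=> t x y; rewrite /fflv_linear scaler_sumr -big_split.
apply: eq_bigr => i _; rewrite scaler_sumr -big_split.
by apply: eq_bigr => b _; rewrite /= !ffunE scalerDl scalerA.
Qed.

HB.instance Definition _ := GRing.isLinear.Build R {ffun Q3 n.+4 -> R^o}
  'M[R]_(3, n.+4) *:%R fflv_linear fflv_linear_is_linear.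

(** The image of the empty antichain. *)
Definition fflv_origin : 'M[R]_(3, n.+4) := \sum_i delta_mx i (absent_col i).

Lemma fflv_linear_entry x i b : fflv_linear x i (col b) = x (rev_ord i, b).
Proof.
rewrite summxE (bigD1 i) //= summxE (bigD1 b) //= big1 => [|c cb]; last first.
  by rewrite !mxE !eqxx (inj_eq col_inj) eq_sym (negPf cb) col_absent subr0 mulr0.
rewrite big1 => [|j ji]; last first.
  by rewrite summxE big1 // => c _; rewrite !mxE eq_sym (negPf ji) subr0 mulr0.
by rewrite !mxE !eqxx col_absent subr0 mulr1 !addr0.
Qed.

Lemma fflv_linear_inj : injective fflv_linear.
Proof.
move=> x y xy; apply/ffunP => -[i b]; rewrite -[i]rev_ordK.
by rewrite -!fflv_linear_entry xy.
Qed.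

Definition cells (a : {ffun 'I_3 -> 'I_n.+4}) : {set Q3 n.+4} :=
  [set p | a (rev_ord p.1) == col p.2]%SET.

(** The condition for a triple of columns to be recoverable from [cells a]; it
holds for every tuple of the field, but also for triples that are not tuples. *)
Definition encodes (a : {ffun 'I_3 -> 'I_n.+4}) : Prop :=
  forall i, a i = absent_col i \/ exists b, a i = col b.

Lemma fflv_map_cells a : encodes a ->
  fflv_origin + fflv_linear (indicator R (cells a)) = \sum_i delta_mx i (a i).
Proof.
move=> enc; rewrite /fflv_origin /fflv_linear -big_split.
apply: eq_bigr => i _ /=.
have xE b : indicator R (cells a) (rev_ord i, b) = (a i == col b)%:R.
  by rewrite ffunE inE /= rev_ordK.
case: (enc i) => [ai|[b ai]].
  rewrite big1 ?addr0 ?ai // => b _.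
  by rewrite xE ai eq_sym col_absent scale0r.
rewrite (bigD1 b) //= big1 => [|c cb]; last first.
  by rewrite xE ai (inj_eq col_inj) eq_sym (negPf cb) scale0r.
by rewrite xE ai eqxx scale1r addr0 addrC subrK.
Qed.

(** Two cells in distinct rows are incomparable exactly when their columns, with
rows reversed, increase strictly.  The inequalities of a tuple that involve an
empty row hold automatically, because the column recording it is extreme. *)
Lemma antichain_cells_tuple a : encodes a ->
  antichain (cells a) <-> matching_field_tuple (block_diagonal_weight n.+4) a.
Proof.
move=> enc; rewrite block_diagonal_tupleP.
have [e0 e1 e2] := val_absent_col.
have aP i : a i = absent_col i :> nat \/ exists b, a i = col b /\ (2 <= a i < n.+3)%N.
  case: (enc i) => [->|[b ->]]; [by left | right; exists b; split=> //].
  by rewrite val_col; have := ltn_ord b; lia.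
split=> [anti|aM].
  have lt_ij (i j : 'I_3) b c : (i < j)%N -> a i = col b -> a j = col c -> (a i < a j)%N.
    move=> ij ai aj; rewrite ltnNge; apply/negP => ji.
    have : (rev_ord j, c) = (rev_ord i, b) :> Q3 n.+4.
      apply: anti; rewrite ?inE /= ?rev_ordK ?ai ?aj //.
      rewrite Order.ProdOrder.leEprod /=; apply/andP; split.
        by rewrite leEord /=; lia.
      by rewrite leEord; move: ji; rewrite ai aj !val_col.
    by case=> eij _; have := ltn_ord i; have := ltn_ord j; lia.
  have lt01 : (r0 < r1)%N by rewrite !inordK.
  have lt02 : (r0 < r2)%N by rewrite !inordK.
  have lt12 : (r1 < r2)%N by rewrite !inordK.
  have {}lt_ij (i j : 'I_3) :
      (i < j)%N -> (2 <= a i < n.+3)%N -> (2 <= a j < n.+3)%N -> (a i < a j)%N.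
    by move=> ij /col_cover[b ab] /col_cover[c ac]; exact: lt_ij ij ab ac.
  have := lt_ij _ _ lt01; have := lt_ij _ _ lt02; have := lt_ij _ _ lt12.
  have := aP r0; have := aP r1; have := aP r2; rewrite e0 e1 e2.
  by move=> [?|[? [_ ?]]] [?|[? [_ ?]]] [?|[? [_ ?]]]; lia.
move=> [i b] [j c]; rewrite !inE /= => /eqP ai /eqP aj.
rewrite Order.ProdOrder.leEprod /= !leEord => /andP[ij bc].
have [ij_eq|ij_ne] := eqVneq i j.
  by move: ai aj; rewrite ij_eq => -> /col_inj->.
have ba := congr1 val ai; have ca := congr1 val aj.
rewrite /= !val_col in ba ca.
have ji : (rev_ord j < rev_ord i)%N.
  by move: ij_ne; rewrite -val_eqE /=; have := ltn_ord i; have := ltn_ord j; lia.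
have lt_a : (a (rev_ord j) < a (rev_ord i))%N.
  move: ji ba ca; case: aM => /andP[_ lt02].
  case: (ord3P (rev_ord i)) => ->; case: (ord3P (rev_ord j)) => ->; rewrite /= ?inordK //.
  - by case=> [->|/andP[]].
  - by case=> [->|/andP[]].
by move: lt_a; rewrite ba ca; move: bc; lia.
Qed.

Lemma image_antichains :
  [set fflv_origin + fflv_linear x
     | x in [set indicator R A | A in [set A : {set Q3 n.+4} | antichain A]]] =
  [set x | exists a : {ffun 'I_3 -> 'I_n.+4},
     matching_field_tuple (block_diagonal_weight n.+4) a /\
     x = \sum_(i < 3) delta_mx i (a i)].
Proof.
have [e0 e1 e2] := val_absent_col.
apply/seteqP; split=> [_ [_ [A antiA <-] <-]|_ [a [aM ->]]].
  pose a : {ffun 'I_3 -> 'I_n.+4} := [ffun i =>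
    if [pick b | (rev_ord i, b) \in A] is Some b then col b else absent_col i].
  have enc : encodes a.
    by move=> i; rewrite ffunE; case: pickP => [b _|_]; [right; exists b | left].
  have cellsE : cells a = A.
    apply/setP => -[i b]; rewrite inE ffunE /= rev_ordK.
    case: pickP => [c cA|noA]; last first.
      by rewrite eq_sym col_absent noA.
    rewrite (inj_eq col_inj); apply/eqP/idP => [<- //|bA].
    have cb : ((i, c) <= (i, b) :> Q3 n.+4)%O \/ ((i, b) <= (i, c) :> Q3 n.+4)%O.
      rewrite !Order.ProdOrder.leEprod /= lexx /=; apply/orP; exact: le_total.
    by case: cb => le_cb; [have [] := antiA _ _ cA bA le_cb | have [] := antiA _ _ bA cA le_cb].
  exists a; split; first by apply/antichain_cells_tuple => //; rewrite cellsE.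
  by rewrite -cellsE fflv_map_cells.
have enc : encodes a.
  move=> i; have [/andP[a0 a02] a1] := (block_diagonal_tupleP a).1 aM.
  have := ltn_ord (a r2); have := @col_cover (a i).
  have : a i = absent_col i :> nat \/ (2 <= a i < n.+3)%N.
    by case: (ord3P i) => ->; rewrite ?e0 ?e1 ?e2; have := ltn_ord (a r2); lia.
  by case=> [/val_inj ->|ai /(_ ai)]; [left | right].
exists (indicator R (cells a)); last exact: fflv_map_cells.
by exists (cells a) => //; apply/antichain_cells_tuple.
Qed.
End FFLV.

Theorem theorem3p1 (R : realType) (n : nat) (hn : (3 < n)%N) :
  unimodular_equivalent (FFLV_polytope R n)
    (matching_field_polytope R (block_diagonal_weight n)).
Proof.
case: n hn => [|[|[|[|n]]]] // _.
apply: (affine_unimodular_equivalent (w0 := fflv_origin R n)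
  (@fflv_linear_inj R n)).
rewrite /FFLV_polytope chain_polytope_conv_hull.
by rewrite image_conv_hull image_antichains.
Qed.
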